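(* Each of the semirings $R_{01},R_{02},R_{11},R_{12}$ is nonfinitely based, i.e. its set of identities does not follow from any finite set of identities valid in it.
   Context: Let $M=\{0,c,p,q,a,b\}$ be the commutative semigroup whose only nonzero products are $pb=bp=ab=ba=aq=qa=c$ (every other product, including every square, is $0$). For $i,j\in\{0,1,2\}$, $R_{ij}$ is the commutative additively idempotent semiring on $M$ with this multiplication whose addition is the join operation of the partial order on $M$ generated by $a<p<0$, $b<q<0$, $c<0$, together with: the first $i$ elements of the chain $a<p$ lie below $c$, and the first $j$ elements of the chain $b<q$ lie below $c$. The language has the two binary operation symbols $+,\cdot$ and no constants. *)

(* Defs.v *)
From Stdlib Require List.
From HB Require Import structures.
From mathcomp Require Import all_boot.

Set Implicit Arguments.
Unset Strict Implicit.
Unset Printing Implicit Defensive.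

Inductive term : Type :=
  | Var of nat
  | Add of term & term
  | Mul of term & term.

Definition identity : Type := (term * term)%type.

Record algebra : Type := Algebra {
  carrier :> Type;
  add : carrier -> carrier -> carrier;
  mul : carrier -> carrier -> carrier
}.

Fixpoint eval (A : algebra) (v : nat -> A) (t : term) : A :=
  match t with
  | Var n => v n
  | Add s u => add (eval v s) (eval v u)
  | Mul s u => mul (eval v s) (eval v u)
  end.

Definition satisfies (A : algebra) (e : identity) : Prop :=
  forall v : nat -> A, eval v e.1 = eval v e.2.

Definition models (A : algebra) (Sigma : identity -> Prop) : Prop :=
  forall e, Sigma e -> satisfies A e.

(** [B] ranges over all algebras, not only semirings: the commutative additively
    idempotent semiring laws are finitely many identities, so this does not
    change which semirings are finitely based. *)
Definition follows_from (Sigma : identity -> Prop) (e : identity) : Prop :=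
  forall B : algebra, models B Sigma -> satisfies B e.

Definition finitely_based (A : algebra) : Prop :=
  exists s : seq identity,
    models A (fun e => List.In e s) /\
    forall e, satisfies A e -> follows_from (fun e' => List.In e' s) e.

Definition nonfinitely_based (A : algebra) : Prop := ~ finitely_based A.

Record comm_ai_semiring (A : algebra) : Prop := CommAiSemiring {
  ai_addA : associative (@add A);
  ai_addC : commutative (@add A);
  ai_addI : idempotent_op (@add A);
  ai_mulA : associative (@mul A);
  ai_mulC : commutative (@mul A);
  ai_mulDl : left_distributive (@mul A) (@add A)
}.

Inductive M : Type := M0 | Mc | Mp | Mq | Ma | Mb.

Definition M_code (x : M) : 'I_6 :=
  match x with
  | M0 => inord 0 | Mc => inord 1 | Mp => inord 2
  | Mq => inord 3 | Ma => inord 4 | Mb => inord 5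
  end.

Definition M_decode (k : 'I_6) : M :=
  nth M0 [:: M0; Mc; Mp; Mq; Ma; Mb] k.

Lemma M_codeK : cancel M_code M_decode.
Proof. by case; rewrite /M_decode /= inordK. Qed.

HB.instance Definition _ := Finite.copy M (can_type M_codeK).

Definition mulM (x y : M) : M :=
  match x, y with
  | Mp, Mb | Mb, Mp | Ma, Mb | Mb, Ma | Ma, Mq | Mq, Ma => Mc
  | _, _ => M0
  end.

Definition chain_ap : seq M := [:: Ma; Mp].
Definition chain_bq : seq M := [:: Mb; Mq].

(** Meant for [i] and [j] at most 2; larger values act as 2. *)
Definition genM (i j : nat) : rel M := fun x y =>
  (x, y) \in [:: (Ma, Mp); (Mp, M0); (Mb, Mq); (Mq, M0); (Mc, M0)]
          ++ [seq (z, Mc) | z <- take i chain_ap]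
          ++ [seq (z, Mc) | z <- take j chain_bq].

Definition leM (i j : nat) : rel M := connect (genM i j).

Definition is_join (i j : nat) (x y z : M) : bool :=
  [&& leM i j x z, leM i j y z &
      [forall w, leM i j x w ==> leM i j y w ==> leM i j z w]].

(** The default value [M0] is never used, by [addM_join]. *)
Definition addM (i j : nat) (x y : M) : M :=
  odflt M0 [pick z | is_join i j x y z].

Definition R (i j : nat) : algebra := Algebra (addM i j) mulM.

Definition leM_table (i j : nat) (x y : M) : bool :=
  match x, y with
  | M0, M0 | Mc, Mc | Mp, Mp | Mq, Mq | Ma, Ma | Mb, Mb => true
  | _, M0 => true
  | Ma, Mp | Mb, Mq => true
  | Ma, Mc => 0 < i
  | Mp, Mc => 1 < i
  | Mb, Mc => 0 < j
  | Mq, Mc => 1 < j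
  | _, _ => false
  end.

Lemma M_eqE (x y : M) : (x == y) =
  match x, y with
  | M0, M0 | Mc, Mc | Mp, Mp | Mq, Mq | Ma, Ma | Mb, Mb => true
  | _, _ => false
  end.
Proof. by apply/eqP/idP => [->|]; [case: y | case: x; case: y]. Qed.

Lemma leM_tableE i j : leM i j =2 leM_table i j.
Proof.
have gE x y : genM i j x y -> leM_table i j x y.
  rewrite /genM; case: i => [|[|i]]; case: j => [|[|j]];
  by case: x; case: y; rewrite /= !inE !xpair_eqE !M_eqE.
have tT : transitive (leM_table i j).
  by move=> y x z; case: i {gE} => [|[|i]]; case: j => [|[|j]];
     case: x; case: y; case: z.
have tR x : leM_table i j x x by case: x.
move=> x y; apply/idP/idP.
  move=> /connectP[p]; elim: p x => [x _ -> //|z p IHp x /= /andP[xz zp] yE].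
  exact: tT (gE _ _ xz) (IHp _ zp yE).
have g1 u v : genM i j u v -> leM i j u v by exact: connect1.
have [ap p0 bq q0 c0] : [/\ leM i j Ma Mp, leM i j Mp M0, leM i j Mb Mq,
    leM i j Mq M0 & leM i j Mc M0].
  by split; apply: g1; rewrite /genM /= !inE !xpair_eqE !M_eqE.
have a0 := connect_trans ap p0; have b0 := connect_trans bq q0.
have gap : {subset take i chain_ap <= fun z => leM i j z Mc}.
  move=> z zin; apply: g1; rewrite /genM !mem_cat.
  by apply/or3P; apply: Or32; apply/mapP; exists z.
have gbq : {subset take j chain_bq <= fun z => leM i j z Mc}.
  move=> z zin; apply: g1; rewrite /genM !mem_cat.
  by apply/or3P; apply: Or33; apply/mapP; exists z.
case: x; case: y => //= h; rewrite ?[leM _ _ _ _]connect0 //.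
- by apply: gap; case: i h {gE tT tR g1 ap p0 bq q0 c0 a0 b0 gbq} => [|[|i]];
    rewrite //= !inE !M_eqE.
- by apply: gbq; case: j h {gE tT tR g1 ap p0 bq q0 c0 a0 b0 gap} => [|[|j]];
    rewrite //= !inE !M_eqE.
- by apply: gap; case: i h {gE tT tR g1 ap p0 bq q0 c0 a0 b0 gbq} => [|i];
    rewrite //= !inE !M_eqE.
- by apply: gbq; case: j h {gE tT tR g1 ap p0 bq q0 c0 a0 b0 gap} => [|j];
    rewrite //= !inE !M_eqE.
Qed.

Lemma leM_order i j :
  [/\ reflexive (leM i j), antisymmetric (leM i j) & transitive (leM i j)].
Proof.
split=> [x|x y|y x z]; rewrite !leM_tableE; first by case: x.
  by case: x; case: y => // /andP[].
by case: i => [|[|i]]; case: j => [|[|j]]; case: x; case: y; case: z.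
Qed.

Definition join_table (i j : nat) (x y : M) : M :=
  if leM_table i j x y then y else
  if leM_table i j y x then x else
  if leM_table i j x Mc && leM_table i j y Mc then Mc else M0.

Lemma join_tableP i j x y : is_join i j x y (join_table i j x y).
Proof.
rewrite /is_join /join_table !leM_tableE.
apply/and3P; split; [| |apply/forallP => w; rewrite !leM_tableE];
  case: i => [|[|i]]; case: j => [|[|j]]; case: x; case: y => //; by case: w.
Qed.

Lemma addM_join i j x y : is_join i j x y (addM i j x y).
Proof.
rewrite /addM; case: pickP => [z //|/(_ (join_table i j x y))].
by rewrite join_tableP.
Qed.

Lemma addM_tableE i j : addM i j =2 join_table i j.
Proof.
move=> x y; have [_ anti _] := leM_order i j.
case/and3P: (addM_join i j x y) => ax ay /forallP aw.
case/and3P: (join_tableP i j x y) => tx ty /forallP tw.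
apply: anti; apply/andP; split.
  by move: (aw (join_table i j x y)); rewrite tx ty.
by move: (tw (addM i j x y)); rewrite ax ay.
Qed.

Lemma R_comm_ai_semiring i j : comm_ai_semiring (R i j).
Proof.
split=> /= [x y z|x y|x|x y z|x y|x y z]; rewrite ?addM_tableE.
- by case: i => [|[|i]]; case: j => [|[|j]]; case: x; case: y; case: z.
- by case: i => [|[|i]]; case: j => [|[|j]]; case: x; case: y.
- by case: x.
- by case: x; case: y; case: z.
- by case: x; case: y.
- by case: i => [|[|i]]; case: j => [|[|j]]; case: x; case: y; case: z.
Qed.

(* Main.v *)
Require Import Defs.
From mathcomp Require Import all_boot.

Set Implicit Arguments.
Unset Strict Implicit.
Unset Printing Implicit Defensive.

(** To a graph attach the semiring whose elements are the nonempty vertex sets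
    (added by union), c and 0, where 0 is absorbing, c + c = c, c + X = 0, and
    X Y = c if every vertex of X is adjacent to every vertex of Y; all other
    products are 0. If n is odd, x_0 x_1 + ... + x_{n-1} x_0 = x_0 x_0 holds in
    R_ij, where a product equals c only for one factor in {a, p} and the other
    in {b, q}, but it fails in the semiring of the n-cycle.

    That semiring satisfies every identity u = v of R_ij with few variables.
    Suppose that u takes the value c there. Vertices chosen from the values of
    the variables of u miss a vertex of the cycle, so the graph whose edges are
    the summands x y of u can be 2-coloured. Sending the colours to a and b, and
    the variables with value c or 0 to c or 0, makes u take a value at most c in
    R_ij. This persists when one variable is raised to p, which excludes it as
    a summand of v because p is not below c (i < 2), or when two variables not
    adjacent in u are raised to p and q, which excludes their product from v
    because p q = 0. Hence every summand of v takes the value c as well. If u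
    takes a vertex set as its value, it is enough to send variables to a or 0. *)

(** * The semiring order, and terms as joins of words *)

Definition le (A : algebra) (x y : A) : Prop := add x y = y.

(* [word t w]: distributing products over sums turns [t] into a sum of products,
   one of which is [w]. *)
Inductive word : term -> term -> Prop :=
  | WordVar x : word (Var x) (Var x)
  | WordAddl s t w : word s w -> word (Add s t) w
  | WordAddr s t w : word t w -> word (Add s t) w
  | WordMul s t w w' : word s w -> word t w' -> word (Mul s t) (Mul w w').

Lemma word_varE x w : word (Var x) w <-> w = Var x.
Proof. by split=> [H|->]; [inversion H | constructor]. Qed.

Lemma word_addE s t w : word (Add s t) w <-> word s w \/ word t w.
Proof.
split=> [H|[] H]; last exact: WordAddr; last exact: WordAddl.
by inversion H; [left | right].
Qed.

Lemma word_mulE s t w : word (Mul s t) w <->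
  exists w1 w2, [/\ w = Mul w1 w2, word s w1 & word t w2].
Proof.
split=> [H|[w1 [w2 [-> ? ?]]]]; last exact: WordMul.
by inversion H as [| | |s' t' w1 w2]; exists w1, w2.
Qed.

Fixpoint vars (t : term) : seq nat :=
  match t with
  | Var x => [:: x]
  | Add s u | Mul s u => vars s ++ vars u
  end.

Lemma word_var_vars t x : word t (Var x) -> x \in vars t.
Proof.
elim: t => [y|s IHs u IHu|s _ u _] /=.
- by move/word_varE => [->]; rewrite inE.
- by case/word_addE => [/IHs|/IHu]; rewrite mem_cat => ->; rewrite ?orbT.
- by case/word_mulE => [w1 [w2 []]].
Qed.

Lemma word_mul_vars t x y :
  word t (Mul (Var x) (Var y)) -> x \in vars t /\ y \in vars t.
Proof.
elim: t => [z|s IHs u IHu|s _ u _] /=.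
- by move/word_varE.
- by case/word_addE => [/IHs[]|/IHu[]]; rewrite !mem_cat => -> ->;
     rewrite ?orbT.
- case/word_mulE => [_ [_ [[<- <-] /word_var_vars xs /word_var_vars yu]]].
  by rewrite !mem_cat xs yu orbT.
Qed.

(** Products of three factors vanish in [R i j] and in the semiring of a graph, so only the first
    two shapes can take a value other than 0. *)
Lemma wordP t w : word t w ->
  [\/ exists x, w = Var x, exists x y, w = Mul (Var x) (Var y),
      exists w1 w2 w3, w = Mul (Mul w1 w2) w3 |
      exists w1 w2 w3, w = Mul w1 (Mul w2 w3)].
Proof.
elim=> [x|//|//|s u w1 w2 _ IH1 _ IH2]; first by constructor 1; exists x.
case: IH1 => [[x ->]|[x [y ->]]|[x [y [z ->]]]|[x [y [z ->]]]].
- case: IH2 => [[y ->]|[y [z ->]]|[y [z [z' ->]]]|[y [z [z' ->]]]].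
  + by constructor 2; exists x, y.
  + by constructor 4; exists (Var x), (Var y), (Var z).
  + by constructor 4; exists (Var x), (Mul y z), z'.
  + by constructor 4; exists (Var x), y, (Mul z z').
- by constructor 3; exists (Var x), (Var y), w2.
- by constructor 3; exists (Mul x y), z, w2.
- by constructor 3; exists x, (Mul y z), w2.
Qed.

Section WordOrder.
Variables (A : algebra) (semiA : comm_ai_semiring A).
Implicit Types (x y z : A) (t : term) (v : nat -> A).

Lemma le_add x y z : le (add x y) z <-> le x z /\ le y z.
Proof.
case: semiA => addA addC addI _ _ _; rewrite /le; split=> [xyz|[xz yz]].
  by split; rewrite -xyz; [|rewrite (addC x)]; rewrite !addA addI.
by rewrite -addA yz xz.
Qed.

Lemma le_anti x y : le x y -> le y x -> x = y.
Proof. by rewrite /le (ai_addC semiA) => -> ->. Qed.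

(** The spare factor [x] lets the induction pass through products: associativity and commutativity
    move either factor of [Mul s u] into it. *)
Lemma le_eval_mul v t x y :
  le (Defs.mul (eval v t) x) y <->
  forall w, word t w -> le (Defs.mul (eval v w) x) y.
Proof.
case: semiA => _ _ _ mulA mulC mulDl.
elim: t x => [n|s IHs u IHu|s IHs u IHu] x.
- by split=> [H w /word_varE-> //|]; apply; constructor.
- rewrite /= mulDl le_add IHs IHu; split=> [[Hs Hu] w /word_addE[]|H]; auto.
  by split=> w Hw; apply: H; apply/word_addE; [left | right].
- have swap a b : Defs.mul (Defs.mul a b) x = Defs.mul b (Defs.mul a x).
    by rewrite (mulC a) mulA.
  rewrite /= -mulA IHs.
  split=> [H _ /word_mulE[w1 [w2 [-> /H Hw1 Hw2]]]|H w Hw].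
    by move: Hw1; rewrite mulA swap IHu => /(_ _ Hw2); rewrite -swap.
  rewrite mulA swap IHu => w' Hw'; rewrite -swap.
  by apply: (H (Mul w w')); apply: WordMul.
Qed.

(** Addition is the join, and distributivity makes every term the join of its words. *)
Lemma le_eval v t y :
  le (eval v t) y <-> forall w, word t w -> le (eval v w) y.
Proof.
elim: t => [n|s IHs u IHu|s IHs u IHu].
- by split=> [H w /word_varE-> //|]; apply; constructor.
- rewrite /= le_add IHs IHu; split=> [[Hs Hu] w /word_addE[]|H]; auto.
  by split=> w Hw; apply: H; apply/word_addE; [left | right].
- have mulC := ai_mulC semiA; rewrite /= le_eval_mul.
  split=> [H _ /word_mulE[w1 [w2 [-> /H Hw1 Hw2]]]|H w Hw].
    by move: Hw1; rewrite mulC le_eval_mul => /(_ _ Hw2); rewrite mulC.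
  rewrite mulC le_eval_mul => w' Hw'; rewrite mulC.
  by apply: (H (Mul w w')); apply: WordMul.
Qed.

End WordOrder.

(** * Products and order in [R i j] *)

Lemma mulM3l x y z : mulM (mulM x y) z = M0.
Proof. by case: x; case: y; case: z. Qed.

Lemma mulM3r x y z : mulM x (mulM y z) = M0.
Proof. by case: x; case: y; case: z. Qed.

Lemma le_R i j (x y : R i j) : le x y <-> leM_table i j x y.
Proof.
rewrite /le /= addM_tableE /join_table.
by case: i j => [|[|?]] [|[|?]] in x y *; case: x; case: y.
Qed.

Lemma mulM_le_c i j x y : leM_table i j (mulM x y) Mc -> mulM x y = Mc.
Proof. by case: x; case: y. Qed.

(** * The semiring of a graph *)

Section GraphAlgebra.
Variables (V : finType) (e : rel V).
Hypotheses (e_irr : irreflexive e) (e_sym : symmetric e).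

Definition vset : Type := {X : {set V} | X != set0}.

Lemma vsetU_neq0 (X Y : vset) : val X :|: val Y != set0.
Proof. by rewrite setU_eq0 negb_and (valP X). Qed.

Definition vsetU (X Y : vset) : vset := Sub (val X :|: val Y) (vsetU_neq0 X Y).

(** One vertex per set suffices to colour a variable, so there are never more vertices to colour
    than variables. *)
Definition vrep (X : vset) : V := xchoose (set0Pn _ (valP X)).

Lemma vrepP (X : vset) : vrep X \in val X.
Proof. exact: xchooseP. Qed.

Inductive graph_elt : Type := G0 | Gc | GS of vset.

Definition gadd (x y : graph_elt) : graph_elt :=
  match x, y with
  | Gc, Gc => Gc
  | GS X, GS Y => GS (vsetU X Y)
  | _, _ => G0
  end.

Definition joined (X Y : vset) : bool :=
  [forall x in val X, forall y in val Y, e x y].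

Definition gmul (x y : graph_elt) : graph_elt :=
  match x, y with
  | GS X, GS Y => if joined X Y then Gc else G0
  | _, _ => G0
  end.

Definition galg : algebra := Algebra gadd gmul.

Lemma joinedP (X Y : vset) :
  reflect {in val X & val Y, forall x y, e x y} (joined X Y).
Proof.
apply: (iffP 'forall_in_forall_inP) => H x y; last by move=> ? ?; apply: H.
by move=> xX yY; apply: H.
Qed.

Lemma joinedC (X Y : vset) : joined X Y = joined Y X.
Proof. by apply/joinedP/joinedP => H x y xX yY; rewrite e_sym H. Qed.

Lemma joined_irr (X : vset) : joined X X = false.
Proof.
by apply/joinedP => /(_ _ _ (vrepP X) (vrepP X)); rewrite e_irr.
Qed.

Lemma joinedU (X Y Z : vset) : joined (vsetU X Y) Z = joined X Z && joined Y Z.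
Proof.
apply/joinedP/andP => [H|[/joinedP HX /joinedP HY] x z].
  by split; apply/joinedP => x z xX zZ; apply: H => //=; rewrite inE xX ?orbT.
by rewrite inE => /orP[xX|xY] zZ; [apply: HX | apply: HY].
Qed.

Lemma vsetUA : associative vsetU.
Proof. by move=> X Y Z; apply: val_inj; apply: setUA. Qed.

Lemma vsetUC : commutative vsetU.
Proof. by move=> X Y; apply: val_inj; apply: setUC. Qed.

Lemma vsetUU : idempotent_op vsetU.
Proof. by move=> X; apply: val_inj; apply: setUid. Qed.

Lemma galg_semiring : comm_ai_semiring galg.
Proof.
split=> /=.
- by case=> [||X] [||Y] [||Z] //=; rewrite vsetUA.
- by case=> [||X] [||Y] //=; rewrite vsetUC.
- by case=> [||X] //=; rewrite vsetUU.
- by case=> [||X] [||Y] [||Z] //=; do ?case: ifP.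
- by case=> [||X] [||Y] //=; rewrite joinedC.
- by case=> [||X] [||Y] [||Z] //=; rewrite ?joinedU; do ?case: ifP.
Qed.

Lemma gmul3l x y z : gmul (gmul x y) z = G0.
Proof. by case: x y z => [||X] [||Y] [||Z] //=; case: ifP. Qed.

Lemma gmul3r x y z : gmul x (gmul y z) = G0.
Proof. by case: x y z => [||X] [||Y] [||Z] //=; case: ifP. Qed.

Lemma gmul_eq_c x y : gmul x y = Gc ->
  exists X Y, [/\ x = GS X, y = GS Y & joined X Y].
Proof.
by case: x => [||X] //; case: y => [||Y] //=; case: ifP => // XY _; exists X, Y.
Qed.

Lemma le_gc x : le (A := galg) x Gc -> x = Gc.
Proof. by case: x. Qed.

Lemma word_le_gc phi t w : word t w -> le (A := galg) (eval phi w) Gc ->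
  (exists2 x, w = Var x & phi x = Gc) \/
  exists x y, w = Mul (Var x) (Var y) /\
    exists X Y, [/\ phi x = GS X, phi y = GS Y & joined X Y].
Proof.
move=> /wordP[[x ->]|[x [y ->]]|[x [y [z ->]]]|[x [y [z ->]]]] /= /le_gc.
- by left; exists x.
- by move/gmul_eq_c; right; exists x, y.
- by rewrite gmul3l.
- by rewrite gmul3r.
Qed.

(** * Transfer of an identity from [R i j] to the graph semiring *)

Section Transfer.
Variables (i j : nat) (lt_i2 : i < 2).
Variables (phi : nat -> galg) (u v : term) (k : V -> bool).
Hypothesis uv : satisfies (R i j) (u, v).

Let semiR := R_comm_ai_semiring i j.
Let semiG := galg_semiring.

Definition shade (b up : bool) : M :=
  if b then (if up then Mp else Ma) else (if up then Mq else Mb).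

Definition lift (kappa up : nat -> bool) (x : nat) : R i j :=
  match phi x with
  | G0 => M0
  | Gc => Mc
  | GS _ => shade (kappa x) (up x)
  end.

(* Only opposite shades multiply to c, and the pair p, q is the one exception:
   so the raised variables must be pairwise nonadjacent in u. *)
Lemma lift_le_c kappa up : le (eval phi u) (Gc : galg) ->
  (forall x y, word u (Mul (Var x) (Var y)) ->
     kappa x != kappa y /\ ~~ (up x && up y)) ->
  le (eval (lift kappa up) u) (Mc : R i j).
Proof.
move=> /(le_eval semiG) uc ok; apply/(le_eval semiR) => w uw; apply/le_R.
case: (word_le_gc uw (uc _ uw)) => [[x -> px]|[x [y [dw [X [Y [px py _]]]]]]].
  by rewrite /= /lift px.
rewrite dw in uw *; move: (ok _ _ uw) => /= [].
by rewrite /lift px py; case: (kappa x); case: (kappa y);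
   case: (up x); case: (up y).
Qed.

Hypothesis k_ok : forall x y X Y, x \in vars u -> y \in vars u ->
  phi x = GS X -> phi y = GS Y -> e (vrep X) (vrep Y) ->
  k (vrep X) != k (vrep Y).

Lemma transfer_c : le (eval phi u) (Gc : galg) -> le (eval phi v) (Gc : galg).
Proof.
move=> uc; have /(le_eval semiG) ucw := uc.
(* [b] exchanges the two colours; variables whose value is not a vertex set get a dummy colour that
   [lift] ignores. *)
pose kappa b x := b (+) (if phi x is GS X then k (vrep X) else false).
have edge x y : word u (Mul (Var x) (Var y)) ->
    exists X Y, [/\ phi x = GS X, phi y = GS Y & joined X Y].
  move=> uw.
  by case: (word_le_gc uw (ucw _ uw)) => [[//]|[x' [y' [[<- <-]]]]].
have proper b x y : word u (Mul (Var x) (Var y)) -> kappa b x != kappa b y.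
  move=> uw; have [xu yu] := word_mul_vars uw.
  have [X [Y [px py /joinedP XY]]] := edge _ _ uw.
  have := k_ok xu yu px py (XY _ _ (vrepP X) (vrepP Y)).
  by rewrite /kappa px py; case: b; case: (k _); case: (k _).
have liftv b up w :
    (forall x y, word u (Mul (Var x) (Var y)) -> ~~ (up x && up y)) ->
    word v w -> leM_table i j (eval (lift (kappa b) up) w) Mc.
  move=> indep vw; apply/le_R; move: w vw; apply/(le_eval semiR).
  have /= <- := uv (lift (kappa b) up); apply: lift_le_c => // x y uw.
  by split; [apply: proper | apply: indep].
have uneq x y : word u (Mul (Var x) (Var y)) -> x != y.
  by move=> /edge[X [Y [px py XY]]]; apply/eqP => xy; move: XY;
     rewrite xy py in px; case: px => ->; rewrite joined_irr.
apply/(le_eval semiG) => w vw.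
case: (wordP vw) => [[x dw]|[x [y dw]]|[x [y [z dw]]]|[x [y [z dw]]]];
  rewrite {w}dw in vw *.
- have indep s t : word u (Mul (Var s) (Var t)) -> ~~ ((s == x) && (t == x)).
    by move=> /uneq; apply: contra => /andP[/eqP-> /eqP->].
  (* If [x] has a vertex set as value, this exchange gives it the colour that is raised to p, which
     is not below c because [i < 2]. *)
  have := liftv (if phi x is GS X then ~~ k (vrep X) else false) _ _ indep vw.
  rewrite /= /lift /kappa; case: (phi x) => [||X] //=.
  by rewrite eqxx addNb addbb /=; case: i lt_i2 => [|[|?]].
- have vc up indep := mulM_le_c (liftv false up _ indep vw).
  (* Since 0 and c annihilate everything, a product equal to c has no factor sent to 0 or c. *)
  have [X [Y [px py]]] : exists X Y, phi x = GS X /\ phi y = GS Y.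
    have := vc xpred0 (fun _ _ _ => isT); rewrite /= /lift.
    case: (phi x) => [||X] //=; case: (phi y) => [||Y] //=; last by exists X, Y.
    by case: (shade _ _).
    by case: (shade _ _).
  rewrite /= px py /=; case: ifP => // nXY.
  have indep s t : word u (Mul (Var s) (Var t)) ->
      ~~ (((s == x) || (s == y)) && ((t == x) || (t == y))).
    move=> ust; have st := uneq _ _ ust.
    have [S [T [ps pt ST]]] := edge _ _ ust.
    apply/negP => /andP[/orP[]/eqP? /orP[]/eqP?]; subst s t;
      rewrite ?eqxx // ?px ?py in st ps pt; case: ps pt ST => <- [<-];
      by rewrite ?nXY // joinedC nXY.
  (* With both variables raised the product is p q, p p or q q, hence 0 and not c. *)
  have := vc _ indep; rewrite /= /lift px py !eqxx orbT.
  by case: (kappa _ x); case: (kappa _ y).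
- by have := liftv false xpred0 _ (fun _ _ _ => isT) vw; rewrite /= mulM3l.
- by have := liftv false xpred0 _ (fun _ _ _ => isT) vw; rewrite /= mulM3r.
Qed.

(** Products never take a vertex set as value, so the words of [u] are variables with values inside
    [X]. Sending all variables with such values to a and the others to 0 gives [u] the value a. Only
    a lies below a and no product is a, so every word of [v] is such a variable too. *)
Lemma transfer_vset (X : vset) :
  le (eval phi u) (GS X : galg) -> le (eval phi v) (GS X : galg).
Proof.
have le_GS x : le x (GS X : galg) -> exists Y, x = GS Y.
  by case: x => [||Y] // _; exists Y.
have gmul_GS x y Y : gmul x y <> GS Y.
  by case: x => [||Z] //; case: y => [||T] //=; case: ifP.
move=> /(le_eval semiG) uX.
have ua (f : nat -> R i j) : (forall x, word u (Var x) -> f x = Ma) ->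
    forall w, word v w -> leM_table i j (eval f w) Ma.
  move=> fa w vw; apply/le_R; move: w vw; apply/(le_eval semiR).
  have /= <- := uv f; apply/(le_eval semiR) => w uw; apply/le_R.
  have [Y] := le_GS _ (uX _ uw).
  have [[x dw]|[x [y dw]]|[x [y [z dw]]]|[x [y [z dw]]]] := wordP uw;
    rewrite dw in uw * => /=; try by move/gmul_GS.
  by rewrite fa.
have le_GSE Y : le (GS Y : galg) (GS X) <-> val Y \subset val X.
  split=> [[YX]|/setUidPr YX]; first by apply/setUidPr; rewrite -{2}YX.
  by congr GS; apply: val_inj.
pose below x := if phi x is GS Y then val Y \subset val X else false.
have ub x : word u (Var x) -> (if below x then Ma else M0) = Ma.
  move=> /uX /= xX; have [Y xY] := le_GS _ xX.
  by move: xX; rewrite /below xY => /le_GSE ->.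
have mulMa x y : leM_table i j (mulM x y) Ma = false by case: x; case: y.
apply/(le_eval semiG) => w vw; have := ua _ ub _ vw.
have [[x ->]|[x [y ->]]|[x [y [z ->]]]|[x [y [z ->]]]] := wordP vw;
  rewrite /= ?mulMa // /below.
by case: (phi x) => [||Y] //; case: ifP => // YX _; apply/le_GSE.
Qed.

Lemma transfer : le (eval phi v) (eval phi u).
Proof.
(* 0 is the top element, so only c and vertex sets need an argument. *)
case uE: (eval phi u) => [||X]; first by case: (eval phi v).
- by apply: transfer_c; rewrite uE.
- by apply: transfer_vset; rewrite uE; apply: ai_addI semiG _.
Qed.

End Transfer.

Definition locally_bipartite (n : nat) : Prop :=
  forall r : seq V, size r <= n ->
  exists k : V -> bool, {in r &, forall x y, e x y -> k x != k y}.

(** The transfer is applied in both directions, each time with a colouring for the side it starts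
    from. *)
Lemma galg_satisfies_local i j n u v : i < 2 -> locally_bipartite n ->
  size (vars u) <= n -> size (vars v) <= n ->
  satisfies (R i j) (u, v) -> satisfies galg (u, v).
Proof.
move=> lt_i2 bip un vn uv phi /=.
pose vert x := if phi x is GS X then Some (vrep X) else None.
have colour t : size (vars t) <= n -> exists k : V -> bool,
    forall x y X Y, x \in vars t -> y \in vars t ->
    phi x = GS X -> phi y = GS Y -> e (vrep X) (vrep Y) ->
    k (vrep X) != k (vrep Y).
  move=> tn; have [|k kP] := bip (pmap vert (vars t)).
    by rewrite size_pmap (leq_trans (count_size _ _)).
  exists k => x y X Y xt yt px py; apply: kP; rewrite mem_pmap.
    by apply/mapP; exists x; rewrite // /vert px.
  by apply/mapP; exists y; rewrite // /vert py.
have [[ku kuP] [kv kvP]] := (colour u un, colour v vn).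
apply: (le_anti galg_semiring).
  by apply: (transfer lt_i2 _ kvP) => f; symmetry; apply: uv.
exact: (transfer lt_i2 uv kuP).
Qed.

End GraphAlgebra.

(** * Odd cycles and the identities that they refute *)

Section OddCycle.
Variable m : nat.
Let n := m.*2.+3.

Definition cyc_arc (x y : 'I_n) : bool :=
  (x.+1 == y) || (x == n.-1 :> nat) && (y == 0 :> nat).

Definition cyc : rel 'I_n := fun x y => cyc_arc x y || cyc_arc y x.

Lemma cyc_irr : irreflexive cyc.
Proof.
move=> x; rewrite /cyc /cyc_arc orbb gtn_eqF //=.
by case: x => -[|x] /=; rewrite ?andbF.
Qed.

Lemma cyc_sym : symmetric cyc.
Proof. by move=> x y; rewrite /cyc orbC. Qed.

(* A missed vertex w cuts the odd cycle into a path. *)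
Lemma cyc_locally_bipartite : locally_bipartite cyc n.-1.
Proof.
move=> r rn; have [w wr] : exists w, w \notin r.
  apply/existsP; rewrite -negb_forall; apply/negP => /forallP rT.
  have := uniq_leq_size (enum_uniq 'I_n) (fun x _ => rT x).
  by rewrite size_enum_ord ltnNge rn.
(* Parity fails only on the arc from [n.-1] to 0, whose ends are both even; flipping it below [w]
   repairs this arc and keeps the arcs that avoid [w]. *)
exists (fun x : 'I_n => odd x (+) (x < w)) => x y xr yr.
have xw : x != w :> nat by apply: contraNneq wr => /val_inj <-.
have yw : y != w :> nat by apply: contraNneq wr => /val_inj <-.
have arc (s t : 'I_n) : s != w :> nat -> t != w :> nat -> cyc_arc s t ->
    odd s (+) (s < w) != odd t (+) (t < w).
  move=> sw tw /orP[/eqP st|/andP[/eqP sE /eqP tE]].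
    rewrite -st in tw *; rewrite (ltn_neqAle s.+1) tw /=.
    by case: (odd s); case: leq.
  rewrite sE tE in tw *; rewrite lt0n (eq_sym (w : nat)) tw.
  by rewrite ltnNge -ltnS ltn_ord /= !negbK odd_double.
by case/orP => /arc H; [|rewrite eq_sym]; apply: H.
Qed.

Definition cycle_term : term :=
  foldr (fun x t => Add (Mul (Var x) (Var x.+1)) t)
        (Mul (Var n.-1) (Var 0)) (iota 0 n.-1).

Lemma le_cycle_term (A : algebra) (f : nat -> A) (y : A) :
  comm_ai_semiring A ->
  le (eval f cycle_term) y <->
  le (Defs.mul (f n.-1) (f 0)) y /\
  forall x, x < n.-1 -> le (Defs.mul (f x) (f x.+1)) y.
Proof.
move=> semiA; rewrite /cycle_term.
have -> : (forall x, x < n.-1 -> le (Defs.mul (f x) (f x.+1)) y) <->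
    (forall x, x \in iota 0 n.-1 -> le (Defs.mul (f x) (f x.+1)) y).
  by split=> H x; have := H x; rewrite mem_iota.
elim: (iota 0 n.-1) => [|x s IH] /=; first by split=> [|[]].
rewrite (le_add semiA) IH; split=> [[xy [? H]]|[? H]].
  by split=> // z; rewrite inE => /predU1P[->|/H].
split; first by apply: H; rewrite inE eqxx.
by split=> // z zs; apply: H; rewrite inE zs orbT.
Qed.

(** Squares are 0, so the sum must not be c. Otherwise all its products would be c, and the values
    would alternate between {a, p} and its complement around an odd cycle. *)
Lemma R_cycle i j : satisfies (R i j) (cycle_term, Mul (Var 0) (Var 0)).
Proof.
move=> f /=; have semiR := R_comm_ai_semiring i j.
pose side x := if x is (Ma | Mp) then true else false.
have mul_side x y : mulM x y = Mc -> side y = ~~ side x by case: x; case: y.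
have mul_c_or_0 x y : mulM x y = M0 \/ mulM x y = Mc.
  by case: x; case: y; auto.
have c_or_0 : eval f cycle_term = M0 \/ eval f cycle_term = Mc.
  rewrite /cycle_term.
  elim: (iota 0 n.-1) => [|x s IH] /=; first exact: mul_c_or_0.
  by rewrite addM_tableE; case: (mul_c_or_0 (f x) (f x.+1)) => ->;
     case: IH => ->; [left | left | left | right].
have -> : mulM (f 0) (f 0) = M0 by case: (f 0).
case: c_or_0 => // cycle_c; exfalso.
have [lastc arcs] : le (Defs.mul (f n.-1) (f 0)) (Mc : R i j) /\
    forall x, x < n.-1 -> le (Defs.mul (f x) (f x.+1)) (Mc : R i j).
  by apply/le_cycle_term => //; rewrite cycle_c; apply: (ai_addI semiR).
have alt x : x < n -> side (f x) = odd x (+) side (f 0).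
  elim: x => // x IH xn; rewrite (mul_side (f x)) ?IH ?addNb //.
    exact: ltnW.
  exact/mulM_le_c/le_R/arcs.
move/le_R/mulM_le_c/mul_side: lastc; rewrite (alt n.-1) // /= negbK odd_double.
by case: (side _).
Qed.

(** When each variable takes its own vertex as a singleton, all the products on the left are c,
    while the square is 0 because there are no loops. *)
Lemma galg_cycle : ~ satisfies (galg cyc) (cycle_term, Mul (Var 0) (Var 0)).
Proof.
have semiG := galg_semiring cyc_sym.
have ordP x : [set inord x : 'I_n] != set0.
  by apply/set0Pn; exists (inord x); rewrite inE.
pose f x : galg cyc := GS (Sub [set inord x : 'I_n] (ordP x) : vset _).
have fM x y : cyc (inord x) (inord y) -> Defs.mul (f x) (f y) = Gc _.
  move=> xy; rewrite /= ifT //; apply/joinedP => u v.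
  by rewrite !SubK !inE => /eqP-> /eqP->.
suff cycle_c : eval f cycle_term = Gc _.
  by move/(_ f); rewrite [LHS]cycle_c /= (joined_irr cyc_irr).
apply: le_gc; apply/le_cycle_term; first exact: semiG.
split=> [|x xn]; rewrite fM //; rewrite /cyc /cyc_arc !inordK //.
- by rewrite !eqxx orbT.
- by rewrite eqxx.
- exact: ltnW.
Qed.

End OddCycle.

Lemma R_nonfinitely_based i j : i < 2 -> nonfinitely_based (R i j).
Proof.
move=> lt_i2 [s [sR sP]].
(* [m] bounds the variable occurrences on each side of the finitely many identities. The cycle of
   length 2m + 3 is 2-colourable on any 2m + 2 vertices, so it satisfies them all. *)
have [m mP] : exists m, forall u v, List.In (u, v) s ->
    size (vars u) <= m /\ size (vars v) <= m.
  elim: s {sR sP} => [|[u v] s [m mP]]; first by exists 0.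
  exists (maxn (maxn (size (vars u)) (size (vars v))) m).
  move=> u' v' [[<- <-]|/mP[]].
    by rewrite !leq_max !leqnn orbT.
  by rewrite !leq_max => -> ->; rewrite !orbT.
apply: (@galg_cycle m); refine (sP _ (@R_cycle m i j) (galg (@cyc m)) _).
move=> [u v] /[dup] uv /mP[um vm].
have mn : m <= m.*2.+2 by rewrite -addnn -addnS -addnS leq_addr.
apply: (galg_satisfies_local (@cyc_irr m) (@cyc_sym m) lt_i2
         (@cyc_locally_bipartite m)); first exact: leq_trans um mn.
  exact: leq_trans vm mn.
exact: sR.
Qed.

Theorem theorem4p3 :
  [/\ nonfinitely_based (R 0 1), nonfinitely_based (R 0 2),
      nonfinitely_based (R 1 1) & nonfinitely_based (R 1 2)].
Proof. by split; apply: R_nonfinitely_based. Qed.
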